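(* Let $p_1,p_2,\ldots$ be an enumeration of the primes. Let $\alpha=2$ and, for each $n\geq2$, let $d_{n,1}=\prod_{t=1}^n\frac{-1}{p_t^n}$ and $d_{n,2}=\prod_{t=1}^n\frac{2}{p_t^n}$. Then System $( * )$ is strongly partition regular over $\mathbb Q$ and has solutions with all variables in $\mathbb N$, but is not partition regular over $\mathbb G_F$ for any proper nonempty subset $F$ of the set $P$ of all primes.
   Context: $\mathbb N$ denotes the positive integers. For a set $F$ of primes, $\mathbb G_F=\{a/b: a\in\mathbb Z,\ b\in\mathbb N,\ \text{all prime factors of } b \text{ lie in } F\}$. System $( * )$ with $\alpha=2$ is the infinite system of linear equations in unknowns $y_1,y_2$, $x_{n,j}$, $z_n$ ($n\geq2$, $1\leq j\leq n$) consisting of, for every $n\geq2$, the equation $x_{n,1}+\cdots+x_{n,n}+d_{n,1}y_1+d_{n,2}y_2=z_n$. A system is partition regular over a set $S\subseteq\mathbb R$ if, whenever $S\setminus\{0\}$ is finitely coloured, there is a solution with all variables in one colour class. A system with coefficients in a ring $R$ is strongly partition regular over $R$ if, whenever $R$ is finitely coloured, there is a monochromatic solution in which distinct variables take different values.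
   Formalization: The numerators −1 and 2 are taken once, outside the products: d_{n,1} = −1/(p_1…p_n)^n and d_{n,2} = 2/(p_1…p_n)^n; with (−1)^n and 2^n, as literally written, the system has no solution in ℕ. *)

(* Defs.v *)
From HB Require Import structures.
From mathcomp Require Import all_boot all_order all_algebra.
From mathcomp Require Import classical_sets functions.

Set Implicit Arguments.
Unset Strict Implicit.
Unset Printing Implicit Defensive.

Import Order.TTheory GRing.Theory Num.Theory.
Local Open Scope classical_set_scope.
Local Open Scope ring_scope.

Definition primes_set : set nat := [set q | prime q].

(* p_1, p_2, ... lists every prime exactly once; p 0 is unconstrained. *)
Definition prime_enumeration (p : nat -> nat) : Prop :=
  set_bij [set t : nat | (0 < t)%N] primes_set p.

Definition posnat (K : numDomainType) : set K :=
  [set x | exists2 m : nat, (0 < m)%N & x = m%:R].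

Definition GG (F : set nat) : set rat :=
  [set x | exists (a : int) (b : nat),
    [/\ (0 < b)%N, forall q : nat, prime q -> (q %| b)%N -> F q
      & x = a%:~R / b%:R]].

(* A system in the unknowns V is given by the predicate "s is a solution" on
   assignments s : V -> K.  A finite colouring of S \ {0} is represented by an
   arbitrary extension c of it to K; only the values of c on S \ {0} matter. *)
Definition partition_regular (K : numDomainType) (V : Type)
    (sol : (V -> K) -> Prop) (S : set K) : Prop :=
  forall (k : nat) (c : K -> 'I_k),
    exists (s : V -> K) (i : 'I_k),
      sol s /\ forall v : V, [/\ S (s v), s v != 0 & c (s v) = i].

Definition strongly_partition_regular (R : nzRingType) (V : Type)
    (sol : (V -> R) -> Prop) : Prop :=
  forall (k : nat) (c : R -> 'I_k),
    exists (s : V -> R) (i : 'I_k),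
      [/\ sol s, injective s & forall v : V, c (s v) = i].

(* X hn j, with j ranging over 0, ..., n - 1, is x_{n,j+1}.  The bound 1 < n is
   a boolean equation, so its proof does not create additional unknowns. *)
Inductive var : Type :=
  | Y1
  | Y2
  | X (n : nat) (hn : (1 < n)%N) (j : 'I_n)
  | Z (n : nat) (hn : (1 < n)%N).

Definition star_system (K : nzRingType) (d1 d2 : nat -> K) (s : var -> K)
    : Prop :=
  forall (n : nat) (hn : (1 < n)%N),
    \sum_(j < n) s (X hn j) + d1 n * s Y1 + d2 n * s Y2 = s (Z hn).

(* The numerators -1 and 2 multiply the whole product: d_{n,2} = -2 d_{n,1}.
   With a factor -1 (resp. 2) for each t, they would become (-1)^n and 2^n, and
   the system would have no solution in the positive integers, because
   (p_1 ... p_n)^n cannot divide (-1)^n y_1 + 2^n y_2 for all n. *)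
Definition d1 (p : nat -> nat) (n : nat) : rat :=
  - \prod_(1 <= t < n.+1) ((p t)%:R ^+ n)^-1.

Definition d2 (p : nat -> nat) (n : nat) : rat :=
  2 * \prod_(1 <= t < n.+1) ((p t)%:R ^+ n)^-1.

(* Main.v *)
(* With w = 2 y_2 - y_1 and delta_n = prod_(t <= n) p_t^(-n), the equations read
   x_(n,1) + ... + x_(n,n) + delta_n w = z_n.

   Over Q: let A be a piecewise syndetic colour class.  By pigeonhole, every
   rational has a bounded positive multiple that is a difference of A in
   infinitely many ways.  Since Q is divisible, there is N such that for every
   n >= N each rational is z - (x_1 + ... + x_n) with entries in A, so the
   equations with n >= N are solvable whatever the value of w.  Take one N for
   all piecewise syndetic classes.  For n < N, the same pigeonhole, with many
   multipliers treated at once, gives e <> 0 such that many integer multiples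
   l e lie in one piecewise syndetic class A, and such that all the numbers
   c_n = x_(n,2) + ... + x_(n,n) + delta_n w formed from them are differences of
   A in infinitely many ways; then x_(n,1) and z_n = x_(n,1) + c_n are found
   in A.

   Over G_F with a prime q outside F: delta_n w has no denominator divisible
   by q, for all n, which forces w = 0, that is y_1 = 2 y_2.  Colouring by the
   parity of the 2-adic valuation excludes this. *)

Require Import Defs.
From HB Require Import structures.
From mathcomp Require Import all_boot all_order all_algebra.
From mathcomp Require Import boolp classical_sets functions.
From mathcomp Require Import zify ring.

Set Implicit Arguments.
Unset Strict Implicit.
Unset Printing Implicit Defensive.

Import Order.TTheory GRing.Theory Num.Theory.
Local Open Scope classical_set_scope.
Local Open Scope ring_scope.

(** * Finite exceptional lists *)

Lemma rat_fresh (E : seq rat) : exists y, y \notin E.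
Proof.
suff [y Hy] : exists y, forall v, v \in E -> v < y.
  by exists y; apply/negP => /Hy; rewrite ltxx.
elim: E => [|a E [y Hy]]; first by exists 0.
exists (1 + `|a| + `|y|) => v; rewrite inE => /orP[/eqP->|/Hy Hv].
  by rewrite (le_lt_trans (ler_norm a)) // -addrA addrCA ltrDl ltr_wpDr.
by rewrite (lt_trans Hv) // (le_lt_trans (ler_norm y)) // ltrDr ltr_wpDr.
Qed.

(** If each of the finitely many indices fails on some list, all fail on the concatenation. This
    makes a witness independent of the exceptional list. *)
Lemma finite_uniform (I : eqType) (L : seq I) (P : I -> seq rat -> Prop) :
  (forall i E E', {subset E <= E'} -> P i E' -> P i E) ->
  (forall E, exists2 i, i \in L & P i E) ->
  exists2 i, i \in L & forall E, P i E.
Proof.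
move=> Pmono; elim: L => [|i L IH] H; first by have [i] := H [::].
have [Pi|] := EM (forall E, P i E); first by exists i; rewrite ?mem_head.
move=> /existsNP[E0 nP]; case: IH => [E|i' i'L Pi']; last first.
  by exists i'; rewrite // inE i'L orbT.
have [i' + Pi'] := H (E ++ E0); rewrite inE => /orP[/eqP ii'|i'L].
  by case: nP; rewrite -ii'; apply: Pmono Pi' => v; rewrite mem_cat orbC => ->.
by exists i' => //; apply: Pmono Pi' => v; rewrite mem_cat => ->.
Qed.

(** * Thick and piecewise syndetic sets of rationals *)

(* The exceptional list E makes it possible to give different values to all the
   variables. *)
Definition thick (S : set rat) : Prop :=
  forall G E : seq rat,
    exists2 y, y \notin E & forall g, g \in G -> S (y + g).

Definition translates (F : seq rat) (A : set rat) : set rat :=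
  [set s | exists2 f, f \in F & A (s - f)].

Definition pwsyndetic (A : set rat) : Prop :=
  exists F, thick (translates F A).

Definition returns (A : set rat) (d : rat) : Prop :=
  forall E : seq rat,
    exists a, [/\ A a, A (a + d), a \notin E & a + d \notin E].

Lemma thick_sub (S S' : set rat) : S `<=` S' -> thick S -> thick S'.
Proof.
by move=> sub tS G E; have [y yE yG] := tS G E; exists y => // g /yG /sub.
Qed.

Lemma thick_neq0 : thick [set x | x != 0].
Proof.
move=> G E; have [y] := rat_fresh (E ++ map -%R G).
rewrite mem_cat negb_or => /andP[yE yG]; exists y => // g gG /=.
by apply: contra yG; rewrite addr_eq0 => /eqP->; apply: map_f.
Qed.

(** If [A] is not thick, some finite pattern [F] has no translate inside [A] by a number outside
    [E0]; every such translate lying in the union therefore meets [B]. *)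
Lemma thick_setU (A B : set rat) :
  thick (A `|` B) -> thick A \/ pwsyndetic B.
Proof.
move=> tAB; have [|] := EM (thick A); first by left.
move=> /existsNP[F /existsNP[E0 nA]]; right; exists (map -%R F) => G E.
have [y] := tAB [seq g + f | g <- G, f <- F] (E ++ [seq e - g | e <- E0, g <- G]).
rewrite mem_cat negb_or => /andP[yE yE0] yAB; exists y => // g gG.
have [f fF nAf] : exists2 f, f \in F & ~ A (y + g + f).
  apply: contrapT => H; apply: nA; exists (y + g) => [|f fF].
    apply: contra yE0 => yg; apply/allpairsP; exists (y + g, g) => /=.
    by rewrite addrK.
  by apply: contrapT => nAf; apply: H; exists f.
exists (- f); first exact: map_f.
rewrite opprK -addrA.
have [] // := yAB (g + f); first by apply/allpairsP; exists (g, f).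
by rewrite addrA.
Qed.

Lemma pwsyndetic_setU (A B : set rat) :
  pwsyndetic (A `|` B) -> pwsyndetic A \/ pwsyndetic B.
Proof.
move=> [F tF]; have [|tA|[F' tB]] := @thick_setU (translates F A) (translates F B).
- by apply: thick_sub tF => s [f fF [?|?]]; [left|right]; exists f.
- by left; exists F.
right; exists [seq f' + f | f' <- F', f <- F].
apply: thick_sub tB => s [f' f'F' [f fF Bs]].
exists (f' + f); first by apply/allpairsP; exists (f', f).
by rewrite opprD addrA.
Qed.

Lemma pwsyndetic_bigcup (I : eqType) (L : seq I) (A : I -> set rat) :
  pwsyndetic [set x | exists2 i, i \in L & A i x] ->
  exists2 i, i \in L & pwsyndetic (A i).
Proof.
elim: L => [|i L IH].
  by move=> [F tF]; have [y _ /(_ 0)] := tF [:: 0] [::]; case=> // f _ [].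
move=> [F tF].
have [||/IH[i' i'L pA]] := @pwsyndetic_setU (A i) [set x | exists2 i, i \in L & A i x].
- exists F; apply: thick_sub tF => s [f fF [i' + Ai']].
  by rewrite inE => /orP[/eqP ii'|i'L]; exists f => //;
    [left; rewrite -ii'|right; exists i'].
- by exists i; rewrite ?mem_head.
by exists i'; rewrite // inE i'L orbT.
Qed.

Lemma pwsyndetic_scale (A : set rat) (q : rat) : q != 0 ->
  pwsyndetic [set x | A (q * x)] -> pwsyndetic A.
Proof.
move=> q0 [F tF]; exists [seq q * f | f <- F] => G E.
have [y yE yG] := tF [seq q^-1 * g | g <- G] [seq q^-1 * e | e <- E].
exists (q * y) => [|g gG].
  by apply: contra yE => /(map_f (fun e => q^-1 * e)); rewrite mulKf.
have [f fF] := yG _ (map_f (fun g => q^-1 * g) gG).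
by rewrite /= mulrBr mulrDr mulVKf // => Ay; exists (q * f); first exact: map_f.
Qed.

(** * Differences of a piecewise syndetic set *)

Lemma thick_translates_avoid (F : seq rat) (A : set rat) (G E : seq rat) :
  thick (translates F A) ->
  exists y, forall g, g \in G ->
    exists2 f, f \in F & A (y + g - f) /\ y + g - f \notin E.
Proof.
move=> tF.
have [y yE yG] := tF G [seq v - g | v <- [seq e + f | e <- E, f <- F], g <- G].
exists y => g gG; have [f fF Af] := yG g gG; exists f => //; split=> //.
apply: contra yE => ygf; apply/allpairsP; exists (y + g, g); split=> //=.
  by apply/allpairsP; exists (y + g - f, f); rewrite subrK.
by rewrite addrK.
Qed.

(* The multiples m x, 0 <= m <= R, are coloured by the translates of the A j that
   they fall into; two multiples of the same colour give h = m' - m. *)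
Lemma returns_multiples (J : finType) (A : J -> set rat) (c : J -> rat)
    (F : seq rat) :
  (forall j, thick (translates F (A j))) ->
  exists R, forall x, exists h,
    [/\ (0 < h)%N, (h <= R)%N & forall j, returns (A j) (c j * (h%:R * x))].
Proof.
(* [R] counts the ways to assign a translate to every [j]. It does not depend on [x], and the
   [R + 1] multiples outnumber it. *)
move=> tA; pose R := #|{ffun J -> 'I_(size F)}|; exists R => x.
pose P (h : nat) (E : seq rat) := forall j, exists a,
  [/\ A j a, A j (a + c j * (h%:R * x)), a \notin E
    & a + c j * (h%:R * x) \notin E].
have [|E|h hR Ph] := @finite_uniform nat (iota 1 R) P; last first.
- by exists h; move: hR; rewrite mem_iota => /andP[h0 hR]; split=> // j E; apply: Ph.
- have /fin_all_exists[y Hy] j := @thick_translates_avoid F (A j)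
    [seq c j * (m%:R * x) | m <- iota 0 R.+1] E (tA j).
  have /fin_all_exists[phi Hphi] (jm : J * 'I_R.+1) : exists f : 'I_(size F),
      let a := y jm.1 + c jm.1 * ((jm.2 : nat)%:R * x) - F`_f in
      A jm.1 a /\ a \notin E.
    case: jm => j m /=; have [|f fF Af] := Hy j (c j * ((m : nat)%:R * x)).
      by apply: (map_f (fun m : nat => c j * (m%:R * x))); rewrite mem_iota add0n ltn_ord.
    by move: (fF); rewrite -index_mem => iF; exists (Ordinal iF); rewrite /= nth_index.
  pose col m := [ffun j => phi (j, m)].
  have /injectivePn[m [m' mm' Em]] : ~~ injectiveb col.
    apply/injectiveP => /leq_card; rewrite card_ord; apply/negP.
    by rewrite -ltnNge.
  wlog ltmm' : m m' mm' Em / (m < m')%N => [W|].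
    case: (ltngtP m m') => [/W|/W|/val_inj Emm]; first exact.
      by apply; rewrite // eq_sym.
    by rewrite Emm eqxx in mm'.
  exists (m' - m)%N => [|j].
    rewrite mem_iota subn_gt0 ltmm' add1n ltnS.
    by rewrite (leq_trans (leq_subr _ _)) // -ltnS ltn_ord.
  have [A1 E1] := Hphi (j, m); have [A2 E2] := Hphi (j, m').
  move/ffunP: Em => /(_ j); rewrite !ffunE => Em; rewrite /= -Em in A1 E1 A2 E2.
  exists (y j + c j * ((m : nat)%:R * x) - F`_(phi (j, m))).
  suff -> : y j + c j * ((m : nat)%:R * x) - F`_(phi (j, m)) +
      c j * ((m' - m)%N%:R * x) =
      y j + c j * ((m' : nat)%:R * x) - F`_(phi (j, m)) by split.
  by rewrite natrB ?(ltnW ltmm') //; ring.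
move=> h E E' sub PE j; have [a [A1 A2 E1 E2]] := PE j.
by exists a; split=> //; [apply: contra E1|apply: contra E2]; apply: sub.
Qed.

(** The multiplier [h] is not under control, but [h <= R] makes it divide [R!]; hence the start from
    [t / R!]. *)
Lemma returns_divisor (F : seq rat) (A : set rat) (t : rat) :
  thick (translates F A) -> t != 0 ->
  exists s d, [/\ returns A d, d != 0 & t = s%:R * d].
Proof.
move=> tA t0.
have [R HR] := @returns_multiples unit (fun=> A) (fun=> 1) F (fun=> tA).
have [h [h0 hR /(_ tt)]] := HR (t / R`!%:R); rewrite mul1r => ret.
have /dvdnP[s Es] : (h %| R`!)%N by apply: dvdn_fact; rewrite h0.
have R0 : R`!%:R != 0 :> rat by rewrite pnatr_eq0 -lt0n fact_gt0.
exists s, (h%:R * (t / R`!%:R)); split=> //.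
  by rewrite !mulf_neq0 ?invr_eq0 // pnatr_eq0 -lt0n.
by rewrite mulrA -natrM -Es mulrCA divff // mulr1.
Qed.

(** For some [y], both [y] and [y + x] lie in translates of [A], by [f] and [f'] say, so
    [x - (f' - f)] is a difference of [A]. *)
Lemma returns_cover (F : seq rat) (A : set rat) :
  thick (translates F A) ->
  exists T : seq rat, forall x, exists t, [/\ t \in T, x - t != 0 & returns A (x - t)].
Proof.
move=> tA.
have [s [d0 [ret0 d00 _]]] := returns_divisor tA (oner_neq0 _).
pose T := [seq f - f' | f <- F, f' <- F].
(* For [x] in [T] the difference found could be zero; such [x] are served by the fixed nonzero
   return [d0]. *)
exists (T ++ [seq t - d0 | t <- T]) => x.
have [xT|xT] := boolP (x \in T).
  exists (x - d0); rewrite subKr mem_cat; split=> //; apply/orP; right.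
  exact: (map_f (fun t => t - d0)).
pose P t (E : seq rat) := exists a,
  [/\ A a, A (a + (x - t)), a \notin E & a + (x - t) \notin E].
have [|E|t tT Pt] := @finite_uniform _ T P; last first.
- exists t; rewrite mem_cat tT; split=> //.
  by rewrite subr_eq0; apply: contraNneq xT => ->.
- have [y Hy] := @thick_translates_avoid F A [:: 0; x] E tA.
  have [|f fF [A1 E1]] := Hy 0; first by rewrite !inE eqxx.
  have [|f' f'F [A2 E2]] := Hy x; first by rewrite !inE eqxx orbT.
  exists (f' - f); first by apply/allpairsP; exists (f', f).
  exists (y + 0 - f).
  by suff -> : y + 0 - f + (x - (f' - f)) = y + x - f' by []; ring.
move=> t E E' sub [a [A1 A2 E1 E2]].
by exists a; split=> //; [apply: contra E1|apply: contra E2]; apply: sub.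
Qed.

(** * A single equation with n large *)

Definition fresh (A : set rat) (E U : seq rat) : Prop :=
  uniq U /\ forall v, v \in U -> A v /\ v \notin E.

Lemma fresh_cat A E U V :
  fresh A E U -> fresh A (E ++ U) V -> fresh A E (U ++ V).
Proof.
move=> [uU HU] [uV HV]; split.
  rewrite cat_uniq uU uV andbT /=; apply/hasPn => v /HV[_].
  by rewrite mem_cat negb_or => /andP[].
move=> v; rewrite mem_cat => /orP[/HU//|/HV[Av]].
by rewrite mem_cat negb_or => /andP[].
Qed.

Lemma fresh_sub A E U V : uniq V -> {subset V <= U} -> fresh A E U -> fresh A E V.
Proof. by move=> uV sub [_ HU]; split=> // v /sub/HU. Qed.

Lemma fresh_weaken A E E' U : {subset E <= E'} -> fresh A E' U -> fresh A E U.
Proof.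
move=> sub [uU HU]; split=> // v /HU[Av vE]; split=> //.
by apply: contra vE; apply: sub.
Qed.

Lemma fresh_return A d E : returns A d -> d != 0 ->
  exists a, fresh A E [:: a; a + d].
Proof.
move=> /(_ E)[a [A1 A2 E1 E2]] d0; exists a; split.
  by rewrite /= inE -subr_eq0 opprD addrA subrr add0r oppr_eq0 d0.
by move=> v; rewrite !inE => /orP[]/eqP->.
Qed.

Lemma fresh_returns A d s E : returns A d -> d != 0 ->
  exists U V, [/\ size U = s, size V = s, fresh A E (U ++ V)
    & \sum_(v <- V) v = \sum_(v <- U) v + s%:R * d].
Proof.
move=> ret d0; elim: s => [|s [U [V [sU sV fUV sumV]]]].
  by exists [::], [::]; rewrite !big_nil mul0r addr0; split=> //; split.
have [a fa] := fresh_return (E ++ (U ++ V)) ret d0.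
exists (a :: U), (a + d :: V); rewrite /= sU sV !big_cons sumV; split=> //.
  have H : perm_eq ((a :: U) ++ (a + d) :: V) ((U ++ V) ++ [:: a; a + d]).
    by apply/permP => q; rewrite !count_cat /= ?count_cat; lia.
  have [uH HH] := fresh_cat fUV fa.
  by split=> [|v]; rewrite ?(perm_uniq H) ?(perm_mem H)//; apply: HH.
by rewrite -natr1; ring.
Qed.

Lemma fresh_exists (F : seq rat) A n E : thick (translates F A) ->
  exists2 U, size U = n & fresh A E U.
Proof.
move=> /returns_divisor/(_ (oner_neq0 _))[s [d [ret d0 _]]].
have [U [V [sU _ fUV _]]] := fresh_returns n E ret d0.
exists U => //; apply: (fresh_sub _ _ fUV); last by move=> v; rewrite mem_cat => ->.
by case: fUV; rewrite cat_uniq => /andP[].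
Qed.

(* The entries of b enter the equation with a plus sign, whereas the returns only
   give differences of elements of A: to add t, summands already present in b are
   exchanged for others, and the length K does not change. *)
Lemma fresh_shifts (F : seq rat) A (T : seq rat) : thick (translates F A) ->
  exists K, forall E, exists b, [/\ size b = K, fresh A E b & forall t, t \in T ->
    exists b', [/\ size b' = K, fresh A E b'
      & \sum_(v <- b') v = \sum_(v <- b) v + t]].
Proof.
move=> tA; elim: T => [|t T [K HK]].
  by exists 0%N => E; exists [::]; split=> //; split.
have [s Hs] : exists s, forall E, exists U V, [/\ size U = s, size V = s,
    fresh A E (U ++ V) & \sum_(v <- V) v = \sum_(v <- U) v + t].
  have [->|t0] := eqVneq t 0.
    by exists 0%N => E; exists [::], [::]; rewrite !big_nil addr0; split=> //; split.
  have [s [d [ret d0 ->]]] := returns_divisor tA t0.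
  by exists s => E; apply: fresh_returns.
exists (s + K)%N => E.
have [U [V [sU sV fUV sumV]]] := Hs E.
have [b [sb fb Hb]] := HK (E ++ (U ++ V)).
have [uUV HUV] := fUV; move: uUV; rewrite cat_uniq => /and3P[uU _ uV].
have fU : fresh A E U by apply: (fresh_sub _ _ fUV) => // v; rewrite mem_cat => ->.
have fV : fresh A E V.
  by apply: (fresh_sub _ _ fUV) => // v; rewrite mem_cat orbC => ->.
have subU : {subset E ++ U <= E ++ (U ++ V)}.
  by move=> v; rewrite !mem_cat => /orP[->|->]; rewrite ?orbT.
have subV : {subset E ++ V <= E ++ (U ++ V)}.
  by move=> v; rewrite !mem_cat => /orP[->|->]; rewrite ?orbT.
exists (U ++ b); rewrite size_cat sU sb; split=> //.
  exact/(fresh_cat fU)/(fresh_weaken subU).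
move=> t'; rewrite inE => /orP[/eqP->|/Hb[b' [sb' fb' sumb']]].
  exists (V ++ b); rewrite size_cat sV sb; split=> //.
    exact/(fresh_cat fV)/(fresh_weaken subV).
  by rewrite !big_cat /= sumV addrAC.
exists (U ++ b'); rewrite size_cat sU sb'; split=> //.
  exact/(fresh_cat fU)/(fresh_weaken subU).
by rewrite !big_cat /= sumb' addrA.
Qed.

Definition equation (n : nat) (w : rat) (xs : seq rat) (z : rat) : Prop :=
  size xs = n /\ \sum_(v <- xs) v + w = z.

(** The summands are one end of a return pair whose other end is [z], [K] exchangeable entries, and
    [n - K - 1] fillers. The bound on n thus depends on neither [w] nor [E]. *)
Lemma pwsyndetic_equation A : pwsyndetic A ->
  exists N, forall n, (N <= n)%N -> forall w E,
    exists xs z, equation n w xs z /\ fresh A E (z :: xs).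
Proof.
move=> [F tA]; have [T HT] := returns_cover tA.
have [K HK] := fresh_shifts T tA; exists K.+1 => n Kn w E.
have [f sf ff] := fresh_exists (n - K.+1) E tA.
have [b [sb fb Hb]] := HK (E ++ f).
(* With [z = a], the summand [a + x] would balance the equation. Only [x - t] is a return;
   exchanging [b] for [b'] supplies the missing [t]. *)
pose x := - (w + \sum_(v <- f) v + \sum_(v <- b) v).
have [t [tT xt0 ret]] := HT x.
have [b' [sb' fb' sumb']] := Hb t tT.
have [a fa] := fresh_return (E ++ (f ++ b')) ret xt0.
exists (a + (x - t) :: f ++ b'), a; split; first split.
- by rewrite /= size_cat sf sb'; lia.
- by rewrite big_cons big_cat /= sumb' /x; ring.
have [uH HH] := fresh_cat (fresh_cat ff fb') fa.
have H : perm_eq (a :: a + (x - t) :: f ++ b') ((f ++ b') ++ [:: a; a + (x - t)]).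
  by rewrite perm_sym perm_catC.
by split=> [|v]; rewrite ?(perm_uniq H) ?(perm_mem H)//; apply: HH.
Qed.

(** * Disjoint choices over infinitely many stages *)

(* B n holds values fixed in advance, which stage n may use even if they occur in
   the list E to be avoided. *)
Lemma greedy_disjoint (T : eqType) (B : nat -> seq T) (E0 : seq T)
    (P : nat -> seq T -> Prop) :
  (forall n, {subset B n <= E0}) ->
  (forall n n' v, v \in B n -> v \in B n' -> n = n') ->
  (forall n (E : seq T), exists2 U, P n U
    & forall v, v \in U -> v \in B n \/ v \notin E) ->
  exists2 U : nat -> seq T, forall n, P n (U n)
    & forall n n' v, v \in U n -> v \in U n' -> n = n'.
Proof.
move=> BE0 Bdisj step.
have /choice[g Hg] (nE : nat * seq T) : exists U, P nE.1 U /\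
    forall v, v \in U -> v \in B nE.1 \/ v \notin nE.2.
  by have [U] := step nE.1 nE.2; exists U.
(* [hist n] is [E0] followed by all values chosen before stage [n]. *)
pose hist := fix hist n := if n is m.+1 then hist m ++ g (m, hist m) else E0.
have histS n m : (n <= m)%N -> {subset hist n <= hist m}.
  elim: m => [|m IH]; first by rewrite leqn0 => /eqP-> v.
  rewrite leq_eqVlt ltnS => /orP[/eqP-> v //|/IH sub v /sub /= vm].
  by rewrite mem_cat vm.
have UB n v : v \in g (n, hist n) -> v \in E0 -> v \in B n.
  move=> vU vE0; have [_ /(_ v vU)[//|/negP[]]] := Hg (n, hist n).
  exact: (histS 0%N).
exists (fun n => g (n, hist n)) => [n|n n' v]; first by have [] := Hg (n, hist n).
wlog ltnn' : n n' / (n < n')%N => [W vn vn'|vn vn'].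
  by case: (ltngtP n n') => // [/W|/W W']; [exact|apply/esym/W'].
have vhist : v \in hist n'.
  by apply: (histS n.+1) => //=; rewrite mem_cat vn orbT.
have [_ /(_ v vn')[vB|/negP[]//]] := Hg (n', hist n').
by apply: (Bdisj _ _ v) => //; apply: UB => //; apply: BE0 vB.
Qed.

(** * Monochromatic multiples and the equations with n small *)

Lemma pigeonhole_count (k L : nat) (T : Type) (c : T -> 'I_k) (s : seq T) :
  (k * L < size s)%N -> exists i, (L < count (fun x => c x == i) s)%N.
Proof.
move=> ks; apply/existsP; apply: contraTT ks => /existsPn H; rewrite -leqNgt.
have -> : size s = (\sum_i count (fun x => c x == i) s)%N.
  elim: s {H} => [|x s IH] /=; first by rewrite big1.
  rewrite big_split /= -IH -[LHS]add1n; congr addn.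
  by rewrite (bigD1 (c x)) //= eqxx big1 // => i /negPf; rewrite eq_sym => ->.
rewrite -[leqRHS]/(k * L)%N -[k in leqRHS]card_ord -sum_nat_const.
by apply: leq_sum => i _; rewrite leqNgt.
Qed.

Definition colour_class (k : nat) (c : rat -> 'I_k) (i : 'I_k) : set rat :=
  [set x | c x = i].

(* Otherwise the nonzero rationals would be covered by finitely many dilates of
   colour classes that are not piecewise syndetic. *)
Lemma pwsyndetic_multiples (k : nat) (c : rat -> 'I_k) (M : nat) :
  exists2 x, x != 0 & forall m, (0 < m)%N -> (m <= M)%N ->
    pwsyndetic (colour_class c (c (m%:R * x))).
Proof.
apply: contrapT => H.
pose L := [seq (m, i) | m <- iota 1 M, i <- enum 'I_k].
pose B (mi : nat * 'I_k) : set rat := [set x |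
  ~ pwsyndetic (colour_class c mi.2) /\ c (mi.1%:R * x) = mi.2].
have [|[m i] /allpairsP[[m' i'] [+ _ [-> ->]]] pB] := @pwsyndetic_bigcup _ L B.
  exists [:: 0]; apply: thick_sub thick_neq0 => x /= x0; exists 0; rewrite ?mem_head //.
  rewrite subr0; apply: contrapT => nB; apply: H; exists x => // m m0 mM.
  apply: contrapT => npw; apply: nB; exists (m, c (m%:R * x)); last by [].
  apply/allpairsP; exists (m, c (m%:R * x)); split=> //=.
    by rewrite mem_iota m0 add1n ltnS.
  exact: mem_enum.
rewrite mem_iota /= => /andP[m0 _].
have [F tF] := pB; have [y _ /(_ 0 (mem_head _ _))[f _ [/= npw _]]] := tF [:: 0] [::].
apply: npw; apply: (@pwsyndetic_scale _ m'%:R); first by rewrite pnatr_eq0 -lt0n.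
by exists F; apply: thick_sub tF => x [f' f'F [_ ?]]; exists f'.
Qed.

Lemma pwsyndetic_common_translates (I : finType) (A : I -> set rat) :
  exists F, forall i, pwsyndetic (A i) -> thick (translates F (A i)).
Proof.
have /fin_all_exists[F HF] i : exists F, pwsyndetic (A i) -> thick (translates F (A i)).
  by have [[F tF]|] := EM (pwsyndetic (A i)); [exists F|exists [::]].
exists (flatten [seq F i | i <- enum I]) => i /HF; apply: thick_sub => s [f fF Af].
by exists f => //; apply/flatten_mapP; exists i; rewrite ?mem_enum.
Qed.

(** The order of choice matters: [h] is made to serve every piecewise syndetic class and every
    possible coefficient at once, and only then does the pigeonhole choose the colour [i]. *)
Lemma monochromatic_returns (k : nat) (c : rat -> 'I_k) (N L : nat)
    (delta : nat -> rat) : (forall n, 0 < delta n) ->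
  exists i e (ls : seq nat), [/\ pwsyndetic (colour_class c i), e != 0,
    uniq ls, size ls = L & (forall l, l \in ls -> c (l%:R * e) = i) /\
    forall n (bs : seq nat) l1 l2, (n < N)%N -> (size bs <= N)%N ->
      {subset bs <= ls} -> l1 \in ls -> l2 \in ls ->
      let d := ((\sum_(b <- bs) b)%N%:R + delta n * (2 * l2%:R - l1%:R)) * e in
      returns (colour_class c i) d /\ d != 0].
Proof.
move=> delta_gt0; pose M := (k * L).+1.
(* Multipliers are taken in (M, 2M], so that 2 l2 - l1 > 0. *)
have [F tF] := pwsyndetic_common_translates (colour_class c).
(* The ranges come from multipliers at most [2M]: a sum of at most [N] of them, and [2 l2 - l1]. *)
pose J := ({i : 'I_k | `[< pwsyndetic (colour_class c i) >]} *
  ('I_N * ('I_(N * (2 * M)).+1 * 'I_(4 * M).+1)))%type.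
have [|R HR] := @returns_multiples J (fun j => colour_class c (val j.1))
  (fun j => (j.2.2.1 : nat)%:R + delta j.2.1 * (j.2.2.2 : nat)%:R) F.
  by move=> [[i pwi] _] /=; apply: tF; apply/asboolP.
(* Here [l * e = (l * h) * x] with [l <= 2M] and [h <= R], whence the bound. *)
have [x x0 Hx] := pwsyndetic_multiples c (2 * M * R).
have [h [h0 hR Hh]] := HR x.
pose e := h%:R * x; pose cl (l : nat) := c (l%:R * e).
have [|i Hi] := @pigeonhole_count k L nat cl (iota M.+1 M); first by rewrite size_iota.
pose ls := take L [seq l <- iota M.+1 M | cl l == i].
have sls : size ls = L by rewrite size_takel // size_filter ltnW.
have Hls l : l \in ls -> [/\ (M < l)%N, (l <= 2 * M)%N & cl l = i].
  by move=> /mem_take; rewrite mem_filter mem_iota => /andP[/eqP-> ?]; split=> //; lia.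
have e0 : e != 0 by rewrite mulf_neq0 // pnatr_eq0 -lt0n.
have pw : pwsyndetic (colour_class c i).
  have : (0 < size [seq l <- iota M.+1 M | cl l == i])%N.
    by rewrite size_filter (leq_trans _ Hi).
  rewrite -has_predT => /hasP[l + _]; rewrite mem_filter mem_iota => /andP[/eqP<- lM].
  rewrite /cl /e mulrA -natrM; apply: Hx; first by rewrite muln_gt0 h0 andbT; lia.
  by rewrite leq_mul //; lia.
exists i, e, ls; split=> //; first by rewrite take_uniq // filter_uniq // iota_uniq.
split=> [l /Hls[]//|n bs l1 l2 nN sbs subbs /Hls[l1M l1M' _] /Hls[l2M l2M' _] d].
have sumbs : (\sum_(b <- bs) b <= N * (2 * M))%N.
  apply: (@leq_trans (size bs * (2 * M))); last by rewrite leq_mul2r sbs orbT.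
  rewrite -sum1_size big_distrl /= big_seq [leqRHS]big_seq.
  by apply: leq_sum => b /subbs/Hls[_ ? _]; rewrite mul1n.
have vE : 2 * l2%:R - l1%:R = (2 * l2 - l1)%N%:R :> rat.
  by rewrite natrB ?natrM //; lia.
have uP : (\sum_(b <- bs) b < (N * (2 * M)).+1)%N by [].
have vP : (2 * l2 - l1 < (4 * M).+1)%N by lia.
split.
  have pwb : `[< pwsyndetic (colour_class c i) >] by apply/asboolP.
  by have := Hh (exist _ i pwb, (Ordinal nN, (Ordinal uP, Ordinal vP))); rewrite /= -vE.
rewrite mulf_neq0 // gt_eqF // ltr_wpDl ?ler0n // vE mulr_gt0 // ltr0n; lia.
Qed.

(** * Assembling an injective monochromatic solution over Q *)

Definition prime_powers_inv (p : nat -> nat) (n : nat) : rat :=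
  \prod_(1 <= t < n.+1) ((p t)%:R ^+ n)^-1.

Lemma prime_enumeration_prime p t : prime_enumeration p -> (0 < t)%N -> prime (p t).
Proof. by move=> [pfun _ _]; apply: pfun. Qed.

Lemma prime_powers_inv_gt0 p n : prime_enumeration p -> 0 < prime_powers_inv p n.
Proof.
move=> hp; rewrite /prime_powers_inv big_nat; apply: prodr_gt0 => t /andP[t0 _].
by rewrite invr_gt0 exprn_gt0 // ltr0n prime_gt0 // (prime_enumeration_prime hp).
Qed.

Lemma d12E p n (y1 y2 : rat) :
  d1 p n * y1 + d2 p n * y2 = prime_powers_inv p n * (2 * y2 - y1).
Proof. by rewrite /d1 /d2 -/(prime_powers_inv p n); ring. Qed.

(* Stages 0 and 1 carry y_1 and y_2; for n >= 2, U lists z_n, x_(n,1), ...,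
   x_(n,n). *)
Definition valid_stage (A : set rat) (w : nat -> rat) (y1 y2 : rat) (n : nat)
    (U : seq rat) : Prop :=
  [/\ uniq U, forall v, v \in U -> A v &
    match n with
    | 0 => U = [:: y1]
    | 1 => U = [:: y2]
    | _ => equation n (w n) (behead U) (head 0 U)
    end].

Lemma injective_solution (A : set rat) (dd1 dd2 : nat -> rat) (y1 y2 : rat)
    (U : nat -> seq rat) :
  (forall n, valid_stage A (fun n => dd1 n * y1 + dd2 n * y2) y1 y2 n (U n)) ->
  (forall n n' v, v \in U n -> v \in U n' -> n = n') ->
  exists s : var -> rat,
    [/\ star_system dd1 dd2 s, injective s & forall v, A (s v)].
Proof.
move=> UP Udisj.
(* Each variable gets its stage and its index in the list of that stage; z_n heads the list, hence
   the shift [j.+1]. *)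
pose pos (v : var) := match v with
  | Y1 => (0, 0) | Y2 => (1, 0) | X n _ j => (n, j.+1) | Z n _ => (n, 0) end%N.
pose s v := (U (pos v).1)`_(pos v).2.
have pos_inj : injective pos.
  case=> [||n hn j|n hn] [||n' hn' j'|n' hn'] //= [] => [En|En|En Ej|En|En|En].
  - by move: hn'; rewrite -En.
  - by move: hn'; rewrite -En.
  - by subst n'; rewrite (bool_irrelevance hn' hn) (val_inj Ej).
  - by move: hn; rewrite En.
  - by move: hn; rewrite En.
  - by subst n'; rewrite (bool_irrelevance hn' hn).
have pos_lt v : ((pos v).2 < size (U (pos v).1))%N.
  case: v => [||n hn j|n hn] /=; have [_ _] := UP 0%N; have [_ _] := UP 1%N.
  - by move=> _ ->.
  - by move=> ->.
  - have [_ _] := UP n; case: n hn j => [|[|n]] // _ j [sU _] _ _.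
    by rewrite size_behead in sU; have := ltn_ord j; lia.
  - have [_ _] := UP n; case: n hn => [|[|n]] // _ [sU _] _ _.
    by rewrite size_behead in sU; lia.
have s_mem v : s v \in U (pos v).1 by apply: mem_nth.
exists s; split=> [n hn|v v' svv'|v]; last by have [_ + _] := UP (pos v).1; apply.
- have [_ _] := UP n.
  case: n hn => [|[|n]] // hn [sU]; rewrite -nth0 /s /= => <-; rewrite -addrA; congr +%R.
    rewrite [RHS](big_nth 0) sU big_mkord; by apply: eq_bigr => j _; rewrite nth_behead.
  by have [_ _ ->] := UP 0%N; have [_ _ ->] := UP 1%N.
- apply: pos_inj.
  have E1 : (pos v).1 = (pos v').1.
    by apply: (Udisj _ _ (s v)) => //; rewrite svv'.
  have [uU _ _] := UP (pos v).1.
  move: svv'; rewrite /s -E1 => /eqP; rewrite nth_uniq ?pos_lt // => [/eqP E2|].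
    by rewrite [LHS]surjective_pairing E1 E2 -surjective_pairing.
  by rewrite E1 pos_lt.
Qed.

Lemma star_strongly_partition_regular p : prime_enumeration p ->
  strongly_partition_regular (star_system (d1 p) (d2 p)).
Proof.
move=> hp k c; pose delta := prime_powers_inv p.
have /fin_all_exists[N0 HN0] (i : 'I_k) : exists N, pwsyndetic (colour_class c i) ->
    forall n, (N <= n)%N -> forall w E, exists xs z,
      equation n w xs z /\ fresh (colour_class c i) E (z :: xs).
  have [/pwsyndetic_equation[N HN]|] := EM (pwsyndetic (colour_class c i)).
    by exists N.
  by exists 0%N.
(* The added 2 keeps stages 0 and 1, which carry no equation, below [N]. *)
pose N := (\max_i N0 i).+2.
have [i [e [ls [pw e0 uls sls [cls ret]]]]] :=
  @monochromatic_returns k c N (N * N) delta (fun n => prime_powers_inv_gt0 n hp).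
pose A := colour_class c i.
(* The [N * N] multipliers form [N] blocks of length [N]. Stage [n] uses [n - 1] of its block, for
   x_(n,2), ..., x_(n,n); [maxn] gives stages 0 and 1 one each, for y_1 and y_2. *)
pose blk n := if (n < N)%N then mkseq (fun j => nth 0%N ls (n * N + j)) (maxn n.-1 1)
  else [::].
have blk_ls n : {subset blk n <= ls}.
  move=> l; rewrite /blk; case: ltnP => // nN /mapP[j]; rewrite mem_iota => jn ->.
  by apply: mem_nth; rewrite sls; nia.
have blk_uniq n : uniq (blk n).
  rewrite /blk; case: ltnP => // nN; rewrite map_inj_in_uniq ?iota_uniq // => j j'.
  rewrite !mem_iota => jn jn' /eqP; rewrite nth_uniq ?sls //; [|nia|nia].
  by rewrite eqn_add2l => /eqP.
have blk_disj n n' l : l \in blk n -> l \in blk n' -> n = n'.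
  rewrite /blk; case: ltnP => // nN; case: ltnP => // n'N.
  move=> /mapP[j + ->] /mapP[j']; rewrite !mem_iota => jn jn' /eqP.
  rewrite nth_uniq ?sls //; [|nia|nia] => /eqP /(congr1 (divn^~ N)).
  by rewrite !divnMDl // !divn_small ?addn0 //; lia.
have e_inj : injective (fun l : nat => l%:R * e).
  by move=> l l' /(mulIf e0) /eqP; rewrite eqr_nat => /eqP.
pose B n := [seq l%:R * e | l <- blk n].
have B_A n v : v \in B n -> A v by move=> /mapP[l /blk_ls/cls lA ->].
have B_uniq n : uniq (B n) by rewrite map_inj_uniq.
pose l1 := nth 0%N ls 0; pose l2 := nth 0%N ls N.
have l1ls : l1 \in ls by rewrite mem_nth ?sls.
have l2ls : l2 \in ls by rewrite mem_nth ?sls //; nia.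
pose y1 := l1%:R * e; pose y2 := l2%:R * e.
have [|n n' v|n E|U UP Udisj] := @greedy_disjoint _ B [seq l%:R * e | l <- ls]
    (valid_stage A (fun n => d1 p n * y1 + d2 p n * y2) y1 y2); last first.
- have [s [ss s_inj sA]] := injective_solution UP Udisj.
  by exists s, i.
- have [Nn|nN] := leqP N n.
    have N0n : (N0 i <= n)%N by have := leq_bigmax (F := N0) i; lia.
    have [xs [z [eqn [uU HU]]]] := HN0 i pw n N0n (d1 p n * y1 + d2 p n * y2) E.
    exists (z :: xs) => [|v /HU[]]; last by right.
    split=> // [v /HU[]//|].
    by move: n Nn eqn {N0n} => [|[|n]].
  case: n nN => [|[|n]] nN.
  + exists (B 0%N) => [|v]; [split; [exact: B_uniq|exact: B_A|]|by left].
    by rewrite /B /blk.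
  + exists (B 1%N) => [|v]; [split; [exact: B_uniq|exact: B_A|]|by left].
    by rewrite /B /blk nN /= mul1n addn0.
  set bs := blk n.+2; have sbs : size bs = n.+1 by rewrite /bs /blk nN size_mkseq; lia.
  have [|retd d0] := ret n.+2 bs l1 l2 nN _ (@blk_ls n.+2) l1ls l2ls.
    by rewrite sbs ltnW // ltnW.
  (* [a] becomes the first summand and [a + d] the right-hand side; avoiding [B n.+2] separates them
     from the other summands. *)
  have [a [ua Ha]] := fresh_return (E ++ B n.+2) retd d0.
  set d := (X in returns _ X) in retd d0 ua Ha *.
  have aP v : v \in [:: a; a + d] -> [/\ A v, v \notin E & v \notin B n.+2].
    by move=> /Ha[Av]; rewrite mem_cat negb_or => /andP[].
  have [[aA aE aB] [zA zE zB]] := (aP _ (mem_head _ _), aP _ (mem_last _ _)).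
  exists [:: a + d, a & B n.+2] => [|v].
    split=> [|v|]; last first.
    * split; first by rewrite /= size_map sbs.
      rewrite d12E /= big_cons big_map -mulr_suml -natr_sum /d /y1 /y2 -/bs /delta.
      by ring.
    * by rewrite !inE => /or3P[/eqP->|/eqP->|/B_A].
    move: ua; rewrite /= !inE andbT !negb_or => ua.
    by rewrite eq_sym ua zB aB B_uniq.
  by rewrite !inE => /or3P[/eqP->|/eqP->|]; [right|right|left].
- by move=> /mapP[l lb ->] /mapP[l' lb' /e_inj E]; apply: blk_disj lb _; rewrite E.
- by move=> n v /mapP[l /blk_ls lb ->]; apply: map_f.
Qed.

(** * A solution in the positive integers *)

Lemma star_posnat_solution p : exists s : var -> rat,
  star_system (d1 p) (d2 p) s /\ forall v : var, posnat (s v).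
Proof.
(* The choice y_1 = 2 y_2 makes w vanish in every equation. *)
exists (fun v => match v with Y1 => 2 | Z n _ => n%:R | _ => 1 end); split.
  move=> n hn; rewrite -addrA d12E mulr1 subrr mulr0 addr0.
  by rewrite sumr_const card_ord.
case=> [||n hn j|n hn]; [by exists 2%N|by exists 1%N|by exists 1%N|].
by exists n => //; apply: ltnW.
Qed.

(** * Failure over G_F *)

(** For [q] prime, this is the localization of the integers at [q]. *)
Definition prime_to (q : nat) : set rat :=
  [set x | exists (a : int) (b : nat), ~~ (q %| b)%N /\ x = a%:~R / b%:R].

Lemma GG_prime_to (F : set nat) q : prime q -> ~ F q -> GG F `<=` prime_to q.
Proof.
move=> pq nFq x [a [b [b0 bF ->]]]; exists a, b; split=> //.
by apply/negP => /(bF q pq).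
Qed.

Lemma prime_toD q x y : prime q -> prime_to q x -> prime_to q y -> prime_to q (x + y).
Proof.
move=> pq [a [b [qb ->]]] [a' [b' [qb' ->]]].
exists (a * b'%:Z + a' * b%:Z), (b * b')%N.
rewrite Euclid_dvdM // negb_or qb qb'; split=> //.
have neq0 m : ~~ (q %| m)%N -> m%:R != 0 :> rat.
  by rewrite pnatr_eq0; apply: contra => /eqP->.
by rewrite addf_div ?neq0 // natrM rmorphD !rmorphM.
Qed.

Lemma prime_toN q x : prime_to q x -> prime_to q (- x).
Proof. by move=> [a [b [qb ->]]]; exists (- a), b; rewrite rmorphN mulNr. Qed.

Lemma prime_to_sum q (I : finType) (f : I -> rat) : prime q ->
  (forall i, prime_to q (f i)) -> prime_to q (\sum_i f i).
Proof.
move=> pq fq; elim/big_ind: _ => // [|x y].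
  by exists 0, 1%N; rewrite mul0r dvdn1 neq_ltn prime_gt1 ?orbT.
exact: prime_toD.
Qed.

(** Clearing denominators, every power of [q] divides the numerator [a]; but [q ^ |a|] exceeds
    [|a|], so [a = 0]. *)
Lemma prime_to_divisible (q : nat) (w : rat) : prime q -> prime_to q w ->
  (forall m, exists2 D, (q ^ m %| D)%N & (0 < D)%N /\ prime_to q (D%:R^-1 * w)) -> w = 0.
Proof.
move=> pq [a [b [qb ->]]] H.
have b0 : (0 < b)%N by case: b qb {H} => //; rewrite dvdn0.
have neq0 m : (0 < m)%N -> m%:R != 0 :> rat by rewrite pnatr_eq0 -lt0n.
have aq m : (q ^ m %| `|a|)%N.
  have [D qD [D0 [a' [b' [qb' E]]]]] := H m.
  have b'0 : (0 < b')%N by case: b' qb' {E} => //; rewrite dvdn0.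
  have {}E : (a * b'%:Z)%:~R = (D%:Z * a' * b%:Z)%:~R :> rat.
    rewrite !rmorphM /=; move/(congr1 (fun x => x * (D%:R * b%:R * b'%:R))): E => E.
    transitivity (D%:R^-1 * (a%:~R / b%:R) * (D%:R * b%:R * b'%:R) : rat).
      by field; rewrite !neq0.
    by rewrite E; field; rewrite neq0.
  move/intr_inj: E => /(congr1 absz); rewrite !abszM !absz_nat => E.
  rewrite -(@Gauss_dvdl _ _ b'); last by rewrite coprimeXl // prime_coprime.
  by rewrite E -mulnA dvdn_mulr.
suff -> : a = 0 by rewrite mul0r.
apply/eqP; rewrite -absz_eq0; apply: contraT; rewrite -lt0n => a0.
have := dvdn_leq a0 (aq `|a|%N); rewrite leqNgt ltn_expl //.
exact: prime_gt1.
Qed.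

(** The 2-adic valuation is the difference of the two [logn]; their sum has the same parity and
    stays in [nat]. *)
Definition parity2 (x : rat) : 'I_2 :=
  inord (odd (logn 2 `|numq x| + logn 2 `|denq x|)).

Lemma parity2_double x : x != 0 -> parity2 (2 * x) != parity2 x.
Proof.
move=> x0; have xx0 : 2 * x != 0 by rewrite mulf_neq0.
have E : (`|numq (2 * x)| * `|denq x| = 2 * (`|numq x| * `|denq (2 * x)|))%N.
  rewrite -(absz_nat 2) -!abszM; congr absz; apply: (@intr_inj rat).
  rewrite !rmorphM /= !numqE; ring.
have gt0 y : y != 0 -> ((0 < `|numq y|)%N * (0 < `|denq y|)%N)%type.
  by rewrite !absz_gt0 numq_eq0 denq_neq0 => ->.
move/(congr1 (logn 2)): E; rewrite !lognM ?muln_gt0 ?gt0 // (@logn_prime 2 2) //= => E.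
apply/eqP => /(congr1 val); rewrite /= !inordK ?ltnS ?leq_b1 //.
lia.
Qed.

Lemma star_not_partition_regular p (F : set nat) : prime_enumeration p ->
  F `<` primes_set ->
  ~ partition_regular (star_system (d1 p) (d2 p)) (GG F).
Proof.
move=> hp [_ nF] /(_ 2%N parity2) [s [i [ss Hs]]].
move: nF => /existsNP[q /not_implyP[pq nFq]].
have [_ _ /(_ q pq) [t /= t0 pt]] := hp.
have [_ y20 cy2] := Hs Y2; have [_ _ cy1] := Hs Y1.
have spt v : prime_to q (s v) by have [/(GG_prime_to pq nFq)] := Hs v.
suff /eqP : 2 * s Y2 - s Y1 = 0.
  rewrite subr_eq0 => /eqP y12; have := parity2_double y20.
  by rewrite y12 cy1 cy2 eqxx.
apply: (prime_to_divisible pq) => [|m].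
  by rewrite mulr2n mulrDl mul1r; do !apply: prime_toD => //; apply: prime_toN.
(* [m] ensures the power [q ^ m], [t] puts [q = p t] among the factors, and 2 ensures that equation
   [n] exists. *)
pose n := maxn (maxn m t) 2; have hn : (1 < n)%N by rewrite leq_max orbT.
exists (\prod_(1 <= u < n.+1) p u ^ n)%N.
  rewrite (bigD1_seq t) ?iota_uniq //=; last first.
    by rewrite mem_index_iota t0 ltnS !leq_max leqnn !orbT.
  by rewrite pt dvdn_mulr // dvdn_exp2l // !leq_max leqnn.
split.
  rewrite big_nat; apply: prodn_cond_gt0 => u /andP[u0 _].
  by rewrite expn_gt0 prime_gt0 // (prime_enumeration_prime hp).
have := ss n hn; rewrite -addrA d12E => Ez.
have E : prime_powers_inv p n * (2 * s Y2 - s Y1) =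
    s (Z hn) - \sum_(j < n) s (X hn j).
  by apply/esym/eqP; rewrite subr_eq addrC Ez.
suff -> : (\prod_(1 <= u < n.+1) p u ^ n)%N%:R^-1 = prime_powers_inv p n.
  rewrite E; apply: prime_toD => //; apply: prime_toN.
  by apply: prime_to_sum.
rewrite /prime_powers_inv natr_prod -prodfV; apply: eq_bigr => u _.
by rewrite natrX.
Qed.

Theorem theorem4p6 (p : nat -> nat) (hp : prime_enumeration p) :
  [/\ strongly_partition_regular (star_system (d1 p) (d2 p)),
      (exists s : var -> rat,
         star_system (d1 p) (d2 p) s /\ forall v : var, posnat (s v))
    & forall F : set nat, F `<` primes_set -> F !=set0 ->
        ~ partition_regular (star_system (d1 p) (d2 p)) (GG F)].
Proof.
split; first exact: star_strongly_partition_regular.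
  exact: star_posnat_solution.
by move=> F Fprop _; apply: star_not_partition_regular.
Qed.
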